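(* Let $p$ be a prime, let $0 \leq m \leq p-1$ and $r\geq (m+1)(p+1)-1$. If $p\mid \binom{r}{m}$, that is, $p\mid r-i$ for some $0\leq i\leq m-1$, then (for this $i$) $$\dfrac{V_r}{V_r^{(m+1)}}\simeq \dfrac{V_r}{V_r^{(i+1)}}\oplus \dfrac{V_r^{(i+1)}}{V_r^{(m+1)}}$$ as representations of $\mathrm{GL}_2(\mathbb{F}_p)$ over $\mathbb{F}_p$.
   Context: For $r\ge 0$, $V_r$ is the $r$-th symmetric power of the standard representation of $\mathrm{GL}_2(\mathbb{F}_p)$ over $\mathbb{F}_p$, identified with homogeneous polynomials $P(X,Y)$ of degree $r$ over $\mathbb{F}_p$, with action $\begin{pmatrix} a & b\\ c & d\end{pmatrix}\cdot P(X,Y)=P(aX+cY,bX+dY)$. Let $\theta=X^pY-XY^p$; for $n\ge 0$, $V_r^{(n)}$ is the subrepresentation of $V_r$ consisting of the polynomials divisible by $\theta^{n}$. *)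

(* Defs.v *)
From HB Require Import structures.
From mathcomp Require Import all_boot all_order all_algebra all_fingroup.
From mathcomp Require Import generic_quotient ring_quotient.
From mathcomp Require Import boolp.
From mathcomp Require Import finfield ring.
From mathcomp Require Import mpoly.

Set Implicit Arguments.
Unset Strict Implicit.
Unset Printing Implicit Defensive.

Import GRing.Theory.
Local Open Scope ring_scope.
Local Open Scope quotient_scope.

Record rep (F : fieldType) (G : finGroupType) := Rep {
  rep_space :> lmodType F;
  act : G -> {linear rep_space -> rep_space};
  act1 : forall v, act 1%g v = v;
  actM : forall g h v, act (g * h)%g v = act g (act h v)
}.

Record subrep (F : fieldType) (G : finGroupType) (V : rep F G) := SubRep {
  subrep_pred :> {pred V};
  subrep_closed : submod_closed subrep_pred;
  subrep_act : forall g v, v \in subrep_pred -> act V g v \in subrep_pred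
}.

HB.instance Definition _ F G (V : rep F G) (W : subrep V) :=
  GRing.isSubmodClosed.Build F V (subrep_pred W) (subrep_closed W).

Definition rep_iso (F : fieldType) (G : finGroupType) (U V : rep F G) : Prop :=
  exists f : {linear U -> V},
    bijective f /\ forall g u, f (act U g u) = act V g (f u).

Section Sum.
Variables (F : fieldType) (G : finGroupType) (U V : rep F G).

Definition sum_fun (g : G) (u : U * V) : U * V := (act U g u.1, act V g u.2).

Lemma sum_fun_linear g : linear (sum_fun g).
Proof. by move=> a u v; rewrite /sum_fun /= !linearP. Qed.

HB.instance Definition _ g :=
  GRing.isLinear.Build F (U * V)%type (U * V)%type _ (sum_fun g)
    (sum_fun_linear g).

Lemma sum_fun1 v : sum_fun 1%g v = v.
Proof. by case: v => u v; rewrite /sum_fun /= !act1. Qed.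

Lemma sum_funM g h v : sum_fun (g * h)%g v = sum_fun g (sum_fun h v).
Proof. by rewrite /sum_fun /= !actM. Qed.

Definition sum_rep : rep F G := @Rep F G _ (fun g => sum_fun g) sum_fun1 sum_funM.
End Sum.

Section Sub.
Variables (F : fieldType) (G : finGroupType) (V : rep F G) (W : subrep V).

Definition sub_space := {v : V | v \in W}.
HB.instance Definition _ := SubType.on sub_space.
HB.instance Definition _ := Choice.on sub_space.
HB.instance Definition _ := [SubChoice_isSubLmodule of sub_space by <:].

Definition sub_fun (g : G) (w : sub_space) : sub_space :=
  exist _ (act V g (val w)) (subrep_act g (valP w)).

Lemma sub_fun_linear g : linear (sub_fun g).
Proof. by move=> a u v; apply: val_inj; rewrite /= !linearP. Qed.

HB.instance Definition _ g :=
  GRing.isLinear.Build F sub_space sub_space _ (sub_fun g) (sub_fun_linear g).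

Lemma sub_fun1 v : sub_fun 1%g v = v.
Proof. by apply: val_inj; rewrite /= act1. Qed.

Lemma sub_funM g h v : sub_fun (g * h)%g v = sub_fun g (sub_fun h v).
Proof. by apply: val_inj; rewrite /= actM. Qed.

Definition sub_rep : rep F G :=
  @Rep F G sub_space (fun g => sub_fun g) sub_fun1 sub_funM.

Variable W' : subrep V.

Definition restrict_pred : {pred sub_rep} :=
  fun w : sub_space => (val w : V) \in W'.

Lemma restrict_closed : submod_closed restrict_pred.
Proof.
split; first exact: (rpred0 (subrep_pred W')).
by move=> a u v uW vW; rewrite /restrict_pred unfold_in /= rpredD ?rpredZ.
Qed.

Lemma restrict_act g w :
  w \in restrict_pred -> act sub_rep g w \in restrict_pred.
Proof. exact: subrep_act. Qed.

(* The intersection of [W'] with [W], seen inside [W]. *)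
Definition restrict : subrep sub_rep :=
  @SubRep F G sub_rep restrict_pred restrict_closed restrict_act.
End Sub.

Section Quo.
Variables (F : fieldType) (G : finGroupType) (V : rep F G) (W : subrep V).

Definition quo_space := Quotient.quot (subrep_pred W).
HB.instance Definition _ := GRing.Zmodule.on quo_space.
HB.instance Definition _ := ZmodQuotient.on quo_space.

Definition quo_scale (a : F) : quo_space -> quo_space :=
  lift_op1 quo_space (fun v : V => a *: v).

Lemma quo_eqP (u v : V) :
  reflect (\pi_quo_space u = \pi_quo_space v) (u - v \in W).
Proof. by rewrite Quotient.idealrBE; apply: eqP. Qed.

Lemma pi_scale a : {morph \pi_quo_space : v / a *: v >-> quo_scale a v}.
Proof.
move=> v; unlock quo_scale; apply/quo_eqP.
by rewrite -scalerBr rpredZ //; apply/quo_eqP; rewrite reprK.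
Qed.

Lemma quo_scaleA a b v : quo_scale a (quo_scale b v) = quo_scale (a * b) v.
Proof. by elim/quotW: v => v; rewrite -!pi_scale scalerA. Qed.

Lemma quo_scale1 : left_id 1 quo_scale.
Proof. by elim/quotW => v; rewrite -pi_scale scale1r. Qed.

Lemma quo_scaleDr : right_distributive quo_scale +%R.
Proof.
move=> a; elim/quotW => u; elim/quotW => v.
by rewrite -!raddfD -!pi_scale -raddfD scalerDr.
Qed.

Lemma quo_scaleDl v : {morph quo_scale^~ v : a b / a + b}.
Proof. by elim/quotW: v => v a b; rewrite -!pi_scale -raddfD scalerDl. Qed.

HB.instance Definition _ := GRing.Zmodule_isLmodule.Build F quo_space
  quo_scaleA quo_scale1 quo_scaleDr quo_scaleDl.

Definition quo_fun (g : G) : quo_space -> quo_space :=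
  lift_op1 quo_space (act V g).

Lemma pi_quo_fun g v : \pi_quo_space (act V g v) = quo_fun g (\pi_quo_space v).
Proof.
unlock quo_fun; apply/quo_eqP.
by rewrite -raddfB subrep_act //; apply/quo_eqP; rewrite reprK.
Qed.

Lemma quo_fun_linear g : linear (quo_fun g).
Proof.
move=> a; elim/quotW => u; elim/quotW => v.
have piZ b w : b *: \pi_quo_space w = \pi_quo_space (b *: w).
  by rewrite pi_scale.
by rewrite piZ -raddfD -!pi_quo_fun piZ -raddfD linearP.
Qed.

HB.instance Definition _ g :=
  GRing.isLinear.Build F quo_space quo_space _ (quo_fun g) (quo_fun_linear g).

Lemma quo_fun1 v : quo_fun 1%g v = v.
Proof. by elim/quotW: v => v; rewrite -pi_quo_fun act1. Qed.

Lemma quo_funM g h v : quo_fun (g * h)%g v = quo_fun g (quo_fun h v).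
Proof. by elim/quotW: v => v; rewrite -!pi_quo_fun actM. Qed.

Definition quo_rep : rep F G :=
  @Rep F G quo_space (fun g => quo_fun g) quo_fun1 quo_funM.
End Quo.

Section Substitution.
Variable R : comNzRingType.
Local Notation X := ('X_0 : {mpoly R[2]}).
Local Notation Y := ('X_1 : {mpoly R[2]}).

(* [A] has rows (a, b) and (c, d); the two forms are aX + cY and bX + dY. *)
Definition forms (A : 'M[R]_2) : 2.-tuple {mpoly R[2]} :=
  [tuple A 0 0 *: X + A 1 0 *: Y; A 0 1 *: X + A 1 1 *: Y].

Definition lin_subst (A : 'M[R]_2) (P : {mpoly R[2]}) : {mpoly R[2]} :=
  P \mPo forms A.

HB.instance Definition _ A :=
  GRing.LRMorphism.copy (lin_subst A) (comp_mpoly (forms A)).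

Lemma tnth_forms A i : tnth (forms A) i = A 0 i *: X + A 1 i *: Y.
Proof.
by rewrite (tnth_nth 0); case: i => [[|[|//]] hi] /=;
  congr (A _ _ *: _ + A _ _ *: _); apply: val_inj.
Qed.

Lemma subst1 P : lin_subst 1%:M P = P.
Proof.
rewrite -[RHS]comp_mpoly_id /lin_subst; congr (comp_mpoly _ P).
apply: eq_from_tnth => i; rewrite tnth_mktuple tnth_forms !mxE.
case: i => [[|[|//]] hi]; rewrite -?(inj_eq val_inj) /= scale1r scale0r.
  by rewrite addr0; congr ('X_ _); apply: val_inj.
by rewrite add0r; congr ('X_ _); apply: val_inj.
Qed.

Lemma subst_var A i : lin_subst A 'X_i = A 0 i *: X + A 1 i *: Y.
Proof. by rewrite /lin_subst comp_mpolyXU -tnth_nth tnth_forms. Qed.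

Lemma substZD A c P Q : lin_subst A (c *: P + Q) = c *: lin_subst A P + lin_subst A Q.
Proof. exact: linearP. Qed.

Lemma subst0 A : lin_subst A 0 = 0.
Proof. exact: raddf0. Qed.

Lemma substM A B P : lin_subst (A *m B) P = lin_subst A (lin_subst B P).
Proof.
elim/mpolyind: P => [|c m P _ _ IH]; first by rewrite !subst0.
rewrite (substZD (A *m B)) (substZD B) (substZD A) IH.
congr (_ *: _ + _); rewrite mpolyXE_id !rmorph_prod /=; apply: eq_bigr => i _.
rewrite !rmorphXn /=; congr (_ ^+ _); rewrite !subst_var raddfD /= !linearZ /=.
rewrite !subst_var !mxE !big_ord_recl !big_ord0 !addr0.
have -> : lift ord0 ord0 = 1 :> 'I_2 by apply: val_inj.
rewrite !scalerDr !scalerA !scalerDl addrACA.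
by congr (_ *: _ + _ *: _ + (_ *: _ + _ *: _)); rewrite mulrC.
Qed.

Lemma subst_homog r A P : P \is r.-homog -> lin_subst A P \is r.-homog.
Proof.
move=> homP.
have homf i : tnth (forms A) i \is 1.-homog.
  have homX j : ('X_j : {mpoly R[2]}) \is 1.-homog.
    by rewrite dhomogX; apply/eqP/mdeg1.
  by rewrite tnth_forms rpredD // rpredZ // homX.
rewrite /lin_subst comp_mpolyEX big_seq; apply: rpred_sum => m mP; apply: rpredZ.
rewrite comp_mpolyX -(dhomog_mf homP mP) /= mdegE.
elim/big_rec2: _ => [|i Q d _ homQ]; first exact: dhomog1.
apply: dhomogM; last exact: homQ.
by rewrite -[X in X.-homog]mul1n; apply: dhomogMn.
Qed.

Variable p : nat.

Definition theta : {mpoly R[2]} := X ^+ p * Y - X * Y ^+ p.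

Lemma det2 (A : 'M[R]_2) : \det A = A 0 0 * A 1 1 - A 0 1 * A 1 0.
Proof.
rewrite (expand_det_row _ 0) !big_ord_recl big_ord0 addr0 /cofactor !det_mx11.
rewrite !mxE /= expr0 expr1 mul1r mulN1r mulrN.
by congr (A _ _ * A _ _ - A _ _ * A _ _); apply: val_inj.
Qed.

Lemma subst_theta A : p \in [pchar R] -> (forall a : R, a ^+ p = a) ->
  lin_subst A theta = \det A *: theta.
Proof.
move=> chR powp.
have chP : p \in [pchar {mpoly R[2]}].
  move: chR; rewrite !inE => /andP[-> /eqP p0] /=.
  by rewrite -(rmorph_nat (@mpolyC 2 R)) p0 raddf0.
have powD (a b : R) (P Q : {mpoly R[2]}) :
    (a *: P + b *: Q) ^+ p = a *: P ^+ p + b *: Q ^+ p.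
  by rewrite -!(pFrobenius_autE chP) rmorphD /= !pFrobenius_autE !exprZn !powp.
rewrite /theta raddfB /= !rmorphM /= !rmorphXn /= !subst_var !powD.
rewrite det2.
move: (A 0 0) (A 0 1) (A 1 0) (A 1 1) => a b c d.
rewrite -!mul_mpolyC mpolyCB !mpolyCM.
move: (a%:MP) (b%:MP) (c%:MP) (d%:MP) => {}a {}b {}c {}d.
move: (X ^+ p) (Y ^+ p) X Y => Xp Yp x y.
ring.
Qed.

End Substitution.

Section HomogeneousPolynomials.
Variables (p r : nat) (p_pr : prime p).
Local Notation GL2 := {'GL_2['F_p]}.
Local Notation hpoly := (dhomog 2 'F_p r).

Definition hsubst (g : GL2) (P : hpoly) : hpoly :=
  DHomog (subst_homog (GLval g) (dhomog_is_dhomog P)).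

Lemma hsubst_linear g : linear (hsubst g).
Proof. by move=> a P Q; apply: val_inj; rewrite /= linearP. Qed.

HB.instance Definition _ g :=
  GRing.isLinear.Build 'F_p hpoly hpoly _ (hsubst g) (hsubst_linear g).

Lemma hsubst1 P : hsubst 1%g P = P.
Proof. by apply: val_inj; apply: subst1. Qed.

Lemma hsubstM g h P : hsubst (g * h)%g P = hsubst g (hsubst h P).
Proof. by apply: val_inj; apply: substM. Qed.

Definition Vr : rep 'F_p GL2 :=
  @Rep 'F_p GL2 hpoly (fun g => hsubst g) hsubst1 hsubstM.

Variable n : nat.

Definition theta_pred : {pred Vr} :=
  fun P : hpoly => `[< exists Q, val P = theta 'F_p p ^+ n * Q >].

Lemma theta_closed : submod_closed theta_pred.
Proof.
split; first by apply/asboolP; exists 0; rewrite mulr0.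
move=> a P P' /asboolP[Q PQ] /asboolP[Q' PQ']; apply/asboolP.
by exists (a *: Q + Q'); rewrite mulrDr -scalerAr -PQ -PQ'.
Qed.

Lemma theta_act g P : P \in theta_pred -> act Vr g P \in theta_pred.
Proof.
move=> /asboolP[Q PQ]; apply/asboolP.
have ch : p \in [pchar 'F_p] by apply: pchar_Fp.
have powp (a : 'F_p) : a ^+ p = a.
  by have := expf_card a; rewrite card_Fp.
exists (\det (GLval g) ^+ n *: lin_subst (GLval g) Q).
rewrite [LHS](_ : _ = lin_subst (GLval g) (val P)) // PQ rmorphM rmorphXn /=.
by rewrite (subst_theta _ ch powp) exprZn -scalerAl -scalerAr.
Qed.

(* [p_pr] makes ['F_p] of characteristic [p], hence [theta] semi-invariant. *)
Definition Vtheta : subrep Vr :=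
  @SubRep 'F_p GL2 Vr theta_pred theta_closed theta_act.
End HomogeneousPolynomials.

(* Main.v *)
From HB Require Import structures.
Require Import Defs.
From mathcomp Require Import all_boot all_order all_algebra all_fingroup.
From mathcomp Require Import generic_quotient boolp mpoly finfield ring zify.

(** The polynomial [theta] is, up to sign, the product of the linear forms
    attached to the points of P^1(F_p), so the class of a form P modulo
    [theta ^+ n] amounts to the Taylor coefficients of order less than n of P
    at each of these points.  A jet records such an expansion: for a matrix A
    with rows u and v, [jet A P] is the polynomial P(u + y v) in y.

    In these terms ([VthetaP]) V_r^(n) consists of the forms all of whose jets
    have vanishing coefficients of order j < n.  If p divides r - i, a
    complement of V_r^(i+1) modulo V_r^(m+1) consists of the forms all of whose
    jets have vanishing coefficients of order j with i < j <= m ([Vgap]).  It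
    is a subrepresentation because g acts on P by replacing the jet along A by
    the jet along A g, and its intersection with V_r^(i+1) is V_r^(m+1), since
    the two vanishing conditions together cover the orders 0, ..., m.

    What remains is that V_r is the sum of V_r^(i+1) and this complement.

    - The vanishing condition needs to be checked for one frame (u, v) over
      each point of P^1(F_p) only: any other frame differs by a lower triangular
      matrix, and such matrices preserve the condition ([gap_lower]).  This is
      where p | r - i enters: for the frame (a u, b u + d v) the jet of P is
      P((a + b y) u + d y v), and (a + b y)^(r - i) = (a + b y^p)^s, with
      s = (r - i) / p, is constant modulo y^p, so the coefficients of order at
      most i of the old jet contribute to orders at most i of the new one, or
      to orders at least p.

    - Given P, its coefficients of order n = i + 1, ..., m at the p + 1 chosen
      frames are removed one order at a time ([gap_lift]) by subtracting
      multiples theta^n G.  These have no coefficient of order less than n, and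
      at order n they have the value of G at the point, up to a nonzero factor.
      The degree of G is r - n (p + 1) >= p, and forms of degree at least p
      take arbitrary values at the p + 1 points ([interpolation]).  *)

Set Implicit Arguments.
Unset Strict Implicit.
Unset Printing Implicit Defensive.

Import GRing.Theory.
Local Open Scope ring_scope.

(** * Complements of subrepresentations *)

Section Complement.
Local Open Scope quotient_scope.

Lemma pi_quoZ (F : fieldType) (G : finGroupType) (V : rep F G) (W : subrep V)
    (a : F) (v : V) :
  \pi_(quo_space W) (a *: v) = a *: (\pi_(quo_space W) v : quo_rep W) :> quo_rep W.
Proof. exact: pi_scale. Qed.

Lemma pi_quoD (F : fieldType) (G : finGroupType) (V : rep F G) (W : subrep V)
    (u v : V) :
  \pi_(quo_space W) (u + v)
    = (\pi_(quo_space W) u : quo_rep W) + \pi_(quo_space W) v :> quo_rep W.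
Proof. exact: (raddfD \pi_(quo_space W)). Qed.

Variables (F : fieldType) (G : finGroupType) (V : rep F G) (W W' C : subrep V).
Hypotheses (sub_W : forall v : V, v \in W' -> v \in W)
  (sub_C : forall v : V, v \in W' -> v \in C)
  (cap_WC : forall v : V, v \in W -> v \in C -> v \in W')
  (add_WC : forall v : V, exists2 w : V, w \in W & v - w \in C).

Let ex_part (v : V) : exists w : sub_space W, v - val w \in C.
Proof. by have [w wW vwC] := add_WC v; exists (exist _ w wW). Qed.

Let part (v : V) : sub_space W := sval (cid (ex_part v)).
Let partP v : v - val (part v) \in C.
Proof. exact: svalP (cid (ex_part v)). Qed.

Local Notation piW := (\pi_(quo_space W)).
Local Notation piW' := (\pi_(quo_space W')).
Local Notation piR := (\pi_(quo_space (restrict W W'))).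

Let split_map (x : quo_rep W') : sum_rep (quo_rep W) (quo_rep (restrict W W')) :=
  (piW (repr (x : quo_space W')), piR (part (repr (x : quo_space W')))).

(** The definition of the map goes through chosen representatives and
    decompositions; any others give the same value, as the component in W is
    determined modulo W'. *)
Let split_mapE (v : V) (w : sub_space W) :
  v - val w \in C -> split_map (piW' v) = (piW v, piR w).
Proof.
move=> vwC; have vW' : repr (piW' v) - v \in W'.
  by apply/quo_eqP; rewrite reprK.
congr pair; apply/quo_eqP; first exact: sub_W.
change (val (part (repr (piW' v))) - val w \in W').
set x := repr _ in vW' *; set w' := part x.
apply: cap_WC; first by rewrite rpredB // (valP w', valP w).
have -> : val w' - val w = (v - val w) - (x - val w') + (x - v).
  by rewrite opprB !addrA subrK -!addrA addrC -addrA subrK addrC.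
apply: rpredD; last exact: sub_C.
by apply: rpredB; [exact: vwC | exact: partP].
Qed.

Let split_map_linear : linear split_map.
Proof.
move=> a; elim/quotW => u; elim/quotW => v.
have -> : a *: (piW' u : quo_rep W') + piW' v = piW' (a *: u + v).
  by rewrite [RHS]pi_quoD pi_quoZ.
rewrite (@split_mapE _ (a *: part u + part v)).
  by rewrite !(split_mapE (partP _)); congr pair; rewrite [LHS]pi_quoD pi_quoZ.
by rewrite /= opprD addrACA -scalerBr rpredD ?rpredZ ?partP.
Qed.

Let joined (x : sum_rep (quo_rep W) (quo_rep (restrict W W'))) : quo_rep W' :=
  let u : V := repr (x.1 : quo_space W) in
  let w := repr (x.2 : quo_space (restrict W W')) in
  piW' (u - val (part u) + val w).

Let joinedK : cancel joined split_map.
Proof.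
case=> x y; rewrite /joined /=; set u := repr _; set w := repr _.
rewrite (@split_mapE _ w) ?addrK ?partP //.
congr pair; last exact: reprK.
rewrite -[RHS](reprK (x : quo_space W)) -/u; apply/quo_eqP.
rewrite -addrA addrC addrA subrK; apply: rpredB.
  exact: (valP w).
exact: (valP (part u)).
Qed.

(** Modulo W', the space V is the direct sum of W and C, both of which are
    stable; projecting to W along C gives the second component, and the first
    one is the quotient map. *)
Lemma complement_split :
  rep_iso (quo_rep W') (sum_rep (quo_rep W) (quo_rep (restrict W W'))).
Proof.
pose f : {linear quo_rep W' -> sum_rep (quo_rep W) (quo_rep (restrict W W'))} :=
  HB.pack split_map (GRing.isLinear.Build F _ _ _ split_map split_map_linear).
exists f; split; last first.
  move=> g; elim/quotW => v.
  rewrite [Defs.act _ _ _](_ : _ = piW' (Defs.act V g v));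
    last exact/esym/pi_quo_fun.
  rewrite /f /= (@split_mapE _ (Defs.act (sub_rep W) g (part v))).
    by rewrite (split_mapE (partP _)) /= /sum_fun /= -!pi_quo_fun.
  by rewrite /= -raddfB subrep_act ?partP.
exists joined; last exact: joinedK.
apply: inj_can_sym joinedK _.
apply: (@raddf_inj _ _ f); elim/quotW => v fv0.
(* The first component shows that v lies in W; then v is its own component
   in W, and the second component shows that v lies in W'. *)
have vW : v \in W.
  have /quo_eqP : piW v = piW 0.
    have /(congr1 fst) := etrans (esym (split_mapE (partP v))) fv0.
    by move=> /= ->; rewrite raddf0.
  by rewrite subr0.
pose w : sub_space W := exist _ v vW.
have vwC : v - val w \in C by rewrite subrr rpred0.
have /quo_eqP : piR w = piR 0.
  have /(congr1 snd) := etrans (esym (split_mapE vwC)) fv0.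
  by move=> /= ->; rewrite raddf0.
rewrite subr0 => vW'.
by rewrite -[RHS](raddf0 piW'); apply/quo_eqP; rewrite subr0; exact: vW'.
Qed.

End Complement.

(** * Binary forms and their dehomogenizations *)

Section BinaryForms.
Variable R : comNzRingType.
Local Notation X := ('X_0 : {mpoly R[2]}).
Local Notation Y := ('X_1 : {mpoly R[2]}).

(** Setting X = 1, with y = Y as the remaining variable. *)
Definition dehom (P : {mpoly R[2]}) : {poly R} :=
  mmap (@polyC R) (fun k : 'I_2 => 'X^k) P.

HB.instance Definition _ :=
  GRing.RMorphism.copy dehom (mmap (@polyC R) (fun k : 'I_2 => 'X^k)).

Lemma dehomZ a P : dehom (a *: P) = a *: dehom P.
Proof. by rewrite /dehom mmapZ mul_polyC. Qed.

Lemma dehomX k : dehom 'X_k = 'X^k.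
Proof. by rewrite /dehom mmapX mmap1U. Qed.

Lemma dehom_monomial a b : dehom (X ^+ a * Y ^+ b) = 'X^b.
Proof. by rewrite rmorphM !rmorphXn /= !dehomX expr1n mul1r. Qed.

(** Homogenization in degree r; the inverse of [dehom] between polynomials of
    degree at most r and forms of degree r. *)
Definition bform r (f : {poly R}) : {mpoly R[2]} :=
  \sum_(k < r.+1) f`_k *: (X ^+ (r - k) * Y ^+ k).

Lemma bform_linear r : linear (bform r).
Proof.
move=> a f g; rewrite /bform scaler_sumr -big_split /=; apply: eq_bigr => k _.
by rewrite coefD coefZ scalerDl scalerA.
Qed.

HB.instance Definition _ r :=
  GRing.isLinear.Build R {poly R} {mpoly R[2]} _ (bform r) (bform_linear r).

Lemma bformXn r k : (k <= r)%N -> bform r 'X^k = X ^+ (r - k) * Y ^+ k.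
Proof.
move=> le_kr; rewrite /bform (bigD1 (inord k)) //= !inordK // coefXn eqxx scale1r.
rewrite big1 ?addr0 // => j; rewrite -val_eqE /= inordK // coefXn => /negbTE->.
by rewrite scale0r.
Qed.

Lemma monomialE (m : 'X_{1..2}) : 'X_[m] = X ^+ m 0 * Y ^+ m 1 :> {mpoly R[2]}.
Proof.
rewrite mpolyXE_id !big_ord_recl big_ord0 mulr1.
by congr (_ * 'X_ _ ^+ m _); apply: val_inj.
Qed.

Lemma homog_ind r (K : {mpoly R[2]} -> Prop) :
    K 0 -> (forall a P Q, K P -> K Q -> K (a *: P + Q)) ->
    (forall k, (k <= r)%N -> K (X ^+ (r - k) * Y ^+ k)) ->
  forall P, P \is r.-homog -> K P.
Proof.
move=> K0 KD KX P homP; rewrite [P]mpolyE big_seq.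
elim/big_rec: _ => // m Q mP KQ; apply: (KD) => //.
have := dhomog_mf homP mP; rewrite /= mdegE !big_ord_recl big_ord0 addn0.
rewrite (_ : lift _ _ = 1); last exact: val_inj.
move=> degm; rewrite monomialE -[m 0](addnK (m 1)) degm; apply: KX.
by rewrite -degm leq_addl.
Qed.

Lemma dehomK r P : P \is r.-homog -> bform r (dehom P) = P.
Proof.
elim/homog_ind => [|a {}P Q PK QK|k le_kr]; first by rewrite !raddf0.
  by rewrite raddfD /= dehomZ linearP /= PK QK.
by rewrite dehom_monomial bformXn.
Qed.

Lemma size_dehom r P : P \is r.-homog -> (size (dehom P) <= r.+1)%N.
Proof.
elim/homog_ind => [|a {}P Q sP sQ|k le_kr]; first by rewrite raddf0 size_poly0.
  rewrite raddfD /= dehomZ (leq_trans (size_polyD _ _)) // geq_max sQ.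
  by rewrite (leq_trans (size_scale_leq _ _)).
by rewrite dehom_monomial size_polyXn.
Qed.

Lemma monomial_homog a b : X ^+ a * Y ^+ b \is (a + b).-homog.
Proof.
have homX j k : ('X_j ^+ k : {mpoly R[2]}) \is k.-homog.
  rewrite -[X in X.-homog]mul1n dhomogMn //.
  by rewrite dhomogX; apply/eqP/mdeg1.
exact: dhomogM.
Qed.

Lemma bform_homog r f : bform r f \is r.-homog.
Proof.
apply: rpred_sum => k _; apply: rpredZ.
by have := monomial_homog (r - k) k; rewrite subnK // leq_ord.
Qed.

Lemma bformK r (f : {poly R}) : (size f <= r.+1)%N -> dehom (bform r f) = f.
Proof.
move=> sf; rewrite rmorph_sum /= -[RHS](coefK f) poly_def.
rewrite (big_ord_widen _ (fun k => f`_k *: 'X^k) sf) /=.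
rewrite [RHS]big_mkcond /=; apply: eq_bigr => k _.
rewrite dehomZ dehom_monomial; case: ltnP => // sk.
by rewrite nth_default ?scale0r.
Qed.

Lemma dehom_subst r A f :
  dehom (lin_subst A (bform r f)) =
  \sum_(k < r.+1) f`_k *: ((A 0 0)%:P + A 1 0 *: 'X) ^+ (r - k)
                       * ((A 0 1)%:P + A 1 1 *: 'X) ^+ k.
Proof.
have dehom_var i : dehom (lin_subst A 'X_i) = (A 0 i)%:P + A 1 i *: 'X.
  by rewrite subst_var raddfD /= !dehomZ !dehomX -mul_polyC mulr1.
rewrite /bform (raddf_sum (lin_subst A)) (raddf_sum dehom) /=.
apply: eq_bigr => k _; rewrite linearZ /= dehomZ rmorphM !rmorphXn /=.
by rewrite rmorphM !rmorphXn /= !dehom_var scalerAl.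
Qed.

Lemma homog_dehom_inj r (P Q : {mpoly R[2]}) :
  P \is r.-homog -> Q \is r.-homog -> dehom P = dehom Q -> P = Q.
Proof. by move=> homP homQ PQ; rewrite -(dehomK homP) PQ dehomK. Qed.

Lemma dehom_theta p : dehom (theta R p) = 'X - 'X^p.
Proof. by rewrite raddfB /= !rmorphM !rmorphXn /= !dehomX expr1n !mul1r. Qed.

Lemma theta_homog p : theta R p \is p.+1.-homog.
Proof.
apply: rpredB; last by have := monomial_homog 1 p; rewrite expr1 add1n.
by have := monomial_homog p 1; rewrite expr1 addn1.
Qed.

End BinaryForms.

(** * Taylor expansions along frames *)

Section Jets.
Variable R : comNzRingType.

(** The polynomial P(u + y v) in y, where u and v are the rows of A: the Taylor
    expansion of P at the point u in the direction v. *)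
Definition jet (A : 'M[R]_2) (P : {mpoly R[2]}) : {poly R} :=
  dehom (lin_subst A P).

HB.instance Definition _ A :=
  GRing.RMorphism.copy (jet A) (@dehom R \o lin_subst A).

Lemma jetZ A a P : jet A (a *: P) = a *: jet A P.
Proof. by rewrite /jet linearZ /= dehomZ. Qed.

Lemma jet_linear A : linear (jet A).
Proof. by move=> a P Q; rewrite raddfD /= jetZ. Qed.

Lemma jet_subst A B P : jet A (lin_subst B P) = jet (A *m B) P.
Proof. by rewrite /jet substM. Qed.

(** One frame for each point of P^1: the rows are (1, a) and (0, 1) for the
    affine point a, and (0, 1) and (1, 0) for the point at infinity. *)
Definition pt_mx (u : option R) : 'M[R]_2 :=
  if u is Some a then
    \matrix_(i, j) (if i == 1 then (j == 1)%:R else if j == 0 then 1 else a)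
  else \matrix_(i, j) (i != j)%:R.

Lemma jet_aff r a (f : {poly R}) : (size f <= r.+1)%N ->
  jet (pt_mx (Some a)) (bform r f) = f \Po ('X + a%:P).
Proof.
move=> sf; rewrite /jet dehom_subst !mxE /= scale0r scale1r addr0 addrC.
rewrite -{2}(coefK f) poly_def (big_ord_widen _ (fun k => f`_k *: 'X^k) sf).
rewrite [in RHS]big_mkcond /= (raddf_sum (comp_poly _)) /=.
apply: eq_bigr => k _.
case: ltnP => sk; last by rewrite nth_default // scale0r mul0r raddf0.
by rewrite comp_polyZ comp_Xn_poly expr1n -scalerAl mul1r.
Qed.

Lemma jet_inf r j (f : {poly R}) : (j <= r)%N ->
  (jet (pt_mx None) (bform r f))`_j = f`_(r - j).
Proof.
move=> jr; rewrite /jet dehom_subst !mxE /= !scale1r scale0r addr0 add0r coef_sum.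
rewrite (bigD1 (inord (r - j))) //= inordK ?ltnS ?leq_subr // subKn // expr1n mulr1.
rewrite coefZ coefXn eqxx mulr1 big1 ?addr0 // => k.
rewrite -val_eqE /= inordK ?ltnS ?leq_subr // => /negbTE kj.
rewrite expr1n mulr1 coefZ coefXn; case: eqP => [e|_]; last by rewrite mulr0.
by move: kj; rewrite e subKn ?eqxx // -ltnS.
Qed.

Definition gap i m (f : {poly R}) := forall j, (i < j <= m)%N -> f`_j = 0.

Lemma gap_linear i m a f g : gap i m f -> gap i m g -> gap i m (a *: f + g).
Proof. by move=> gf gg j jim; rewrite coefD coefZ gf // gg // mulr0 addr0. Qed.

Lemma gap_subr i m (f h : {poly R}) : gap i m f ->
  (forall j, (j < m.+1)%N -> h`_j = 0) -> h`_m.+1 = f`_m.+1 ->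
  gap i m.+1 (f - h).
Proof.
move=> gf h0 hf j /andP[ij]; rewrite coefB leq_eqVlt => /predU1P[->|jm].
  by rewrite hf subrr.
by rewrite gf ?ij // h0 // subr0.
Qed.

End Jets.

(** The point spanned by the first row of A has a representative among the
    chosen frames, and frames over the same point differ by a lower triangular
    matrix; if the first row is zero, any point will do. *)
Lemma frame_decomposition (F : fieldType) (A : 'M[F]_2) :
  exists (b : 'M[F]_2) u, b 0 1 = 0 /\ A = b *m pt_mx u.
Proof.
have mul2 (B C : 'M[F]_2) i j : (B *m C) i j = B i 0 * C 0 j + B i 1 * C 1 j.
  rewrite !mxE !big_ord_recl big_ord0 addr0.
  by have -> : lift ord0 ord0 = 1 :> 'I_2 by apply: val_inj.
have ext (B C : 'M[F]_2) :
    (forall i, B i 0 = C i 0) -> (forall i, B i 1 = C i 1) -> B = C.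
  move=> e0 e1; apply/matrixP => i [[|[|//]] hj].
    by have -> : Ordinal hj = 0 by apply: val_inj.
  by have -> : Ordinal hj = 1 by apply: val_inj.
(* The two witnesses are A times the inverse of the frame. *)
have [A0|A0] := eqVneq (A 0 0) 0.
  exists (A *m pt_mx None), None.
  split; first by rewrite mul2 !mxE /= A0; ring.
  by apply: ext => i; rewrite !mul2 !mxE /=; ring.
exists (A *m pt_mx (Some (- (A 0 1 / A 0 0)))), (Some (A 0 1 / A 0 0)).
split; first by rewrite mul2 !mxE /=; field.
by apply: ext => i; rewrite !mul2 !mxE /=; ring.
Qed.

Section ModP.
Variable p : nat.
Hypothesis p_pr : prime p.
Local Notation F := 'F_p.

Let chF : p \in [pchar F]. Proof. exact: pchar_Fp. Qed.
Let powF (a : F) : a ^+ p = a.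
Proof. by have := expf_card a; rewrite card_Fp. Qed.

Let p1n0 : (p.-1 == 0)%N = false.
Proof. by case: p p_pr => [|[|]]. Qed.

(** Let c_k be the coefficients of the old jet.  The new one is the sum of the
    c_k L^(r - k) (d y)^k with L = a + b y, where (a, 0) and (b, d) are the rows
    of the matrix.  The terms with k > m start beyond
    order m.  For k <= i, write L^(r - k) = (L^p)^s L^(i - k) with p s = r - i;
    since L^p = a + b y^p, the factor (L^p)^s is constant modulo y^p, and
    L^(i - k) (d y)^k has degree at most i. *)
Lemma gap_lower r i m (b : 'M[F]_2) P :
  P \is r.-homog -> (i <= r)%N -> (p %| r - i)%N -> (m < p)%N ->
  b 0 1 = 0 -> gap i m (dehom P) -> gap i m (jet b P).
Proof.
move=> homP ir /dvdnP[s rs] mp b01 gapP j /andP[ij jm].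
have chX : p \in [pchar {poly F}] by apply: (rmorph_pchar (@polyC F)).
rewrite -(dehomK homP) /jet dehom_subst b01 add0r coef_sum big1 // => k _.
have [ki|ik] := leqP k i; last first.
  have [km|mk] := leqP k m.
    by rewrite gapP ?scale0r ?mul0r ?coef0 ?ik.
  by rewrite exprZn -scalerAr coefZ coefMXn (leq_ltn_trans jm mk) mulr0.
set L := _%:P + _.
have -> : (r - k = p * s + (i - k))%N by rewrite mulnC -rs addnBA // subnK.
rewrite exprD exprM.
have -> : L ^+ p = (b 0 0)%:P + b 1 0 *: 'X^p.
  rewrite -(pFrobenius_autE chX) rmorphD /= !pFrobenius_autE.
  by rewrite -polyC_exp exprZn !powF.
have [q ->] : exists q : {poly F},
    ((b 0 0)%:P + b 1 0 *: 'X^p) ^+ s = (b 0 0 ^+ s)%:P + q * 'X^p.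
  elim: s {rs} => [|s [q IH]]; first by exists 0; rewrite !expr0 mul0r addr0.
  exists ((b 0 0)%:P * q + b 1 0 *: ((b 0 0 ^+ s)%:P + q * 'X^p)).
  by rewrite exprS IH exprS polyCM -!mul_polyC; ring.
set L' := (_ *: 'X) ^+ k.
have szL : (size (L ^+ (i - k) * L')%R <= i.+1)%N.
  have sz (a c : F) n : (size ((a%:P + c *: 'X) ^+ n)%R <= n.+1)%N.
    apply: leq_trans (size_poly_exp_leq _ _) _.
    rewrite ltnS -[leqRHS]mul1n leq_mul2r; apply/orP; right.
    rewrite -subn1 leq_subLR (leq_trans (size_polyD _ _)) // geq_max.
    rewrite (leq_trans (size_polyC_leq1 _)) //.
    by rewrite (leq_trans (size_scale_leq _ _)) ?size_polyX.
  apply: leq_trans (size_polyMleq _ _) _.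
  have := leq_add (sz (b 0 0) (b 1 0) (i - k)%N) (sz 0 (b 1 1) k).
  by rewrite add0r addSn addnS subnK // -subn1 leq_subLR add1n.
rewrite -scalerAl coefZ -mulrA mulrDl coefD mulrAC coefMXn (leq_ltn_trans jm mp) addr0.
by rewrite mul_polyC coefZ [X in _ * (_ * X)]nth_default ?mulr0 // (leq_trans szL).
Qed.

Lemma jet_theta A n Q :
  jet A (theta F p ^+ n * Q) = (\det A) ^+ n *: (('X - 'X^p) ^+ n * jet A Q).
Proof.
rewrite /jet rmorphM rmorphXn /= (subst_theta _ chF powF) rmorphM rmorphXn /= dehomZ.
by rewrite dehom_theta exprZn scalerAl.
Qed.

Lemma coef_theta_exp n (f : {poly F}) :
  (forall j, (j < n)%N -> (('X - 'X^p) ^+ n * f)`_j = 0) /\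
  (('X - 'X^p) ^+ n * f)`_n = f`_0.
Proof.
have -> : 'X - 'X^p = (1 - 'X^(p.-1)) * 'X :> {poly F}.
  by rewrite mulrBl mul1r -exprSr prednK ?prime_gt0.
rewrite exprMn mulrAC; split=> [j jn|]; first by rewrite coefMXn jn.
rewrite coefMXn ltnn subnn -!horner_coef0 hornerM horner_exp hornerD hornerN hornerXn.
by rewrite hornerC expr0n p1n0 subr0 expr1n mul1r.
Qed.

Lemma pt_mx_det (u : option F) : \det (pt_mx u) != 0.
Proof.
rewrite det2; case: u => [a|]; rewrite !mxE /= ?mulr0 ?mulr1 ?subr0 ?oner_neq0 //.
by rewrite sub0r oppr_eq0 oner_neq0.
Qed.

(** A form of degree s >= p takes arbitrary values at the points of P^1(F_p):
    its value at infinity is the coefficient of degree s of its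
    dehomogenization. *)
Lemma interpolation s (v : option F -> F) : (p <= s)%N ->
  exists g : {poly F},
    [/\ (size g <= s.+1)%N, forall a, g.[a] = v (Some a) & g`_s = v None].
Proof.
move=> ps.
(* 1 - (x - a)^(p - 1) is the indicator function of a, by Fermat. *)
pose L : {poly F} := \sum_a v (Some a) *: (1 - ('X - a%:P) ^+ p.-1).
have szL : (size L <= p)%N.
  apply: (leq_trans (size_sum _ _ _)); apply/bigmax_leqP => a _.
  apply: leq_trans (size_scale_leq _ _) _; apply: leq_trans (size_polyD _ _) _.
  by rewrite size_polyN size_exp_XsubC size_poly1 prednK ?prime_gt0 // geq_max prime_gt0 /=.
have LE a : L.[a] = v (Some a).
  rewrite horner_sum (bigD1 a) //= big1 ?addr0 => [|b ba];
    rewrite hornerZ hornerD hornerN horner_exp hornerXsubC hornerC.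
    rewrite subrr expr0n p1n0 subr0 mulr1 //.
  suff -> : (a - b) ^+ p.-1 = 1 by rewrite subrr mulr0.
  have nz : a - b != 0 by rewrite subr_eq0 eq_sym.
  by apply: (mulfI nz); rewrite -exprS prednK ?prime_gt0 // powF mulr1.
(* The second summand vanishes on F_p and has degree s, while L has degree
   less than p. *)
exists (L + v None *: ('X^(s - p) * ('X^p - 'X))); split.
- apply: leq_trans (size_polyD _ _) _; rewrite geq_max (leq_trans szL (leqW ps)) /=.
  rewrite mulrBr -exprD subnK // -exprSr (leq_trans (size_scale_leq _ _)) //.
  rewrite (leq_trans (size_polyD _ _)) // size_polyN !size_polyXn geq_max leqnn ltnS /=.
  by rewrite ltn_subrL prime_gt0 //= (leq_trans _ ps) ?prime_gt0.
- move=> a; rewrite hornerD LE hornerZ hornerM hornerD hornerN !hornerXn.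
  by rewrite hornerX powF subrr !mulr0 addr0.
rewrite coefD nth_default ?add0r ?(leq_trans szL) // coefZ mulrBr -exprD subnK //.
rewrite -exprSr coefB !coefXn eqxx gtn_eqF ?subr0 ?mulr1 //.
by rewrite -addn2 -[leqRHS](subnK ps) leq_add2l prime_gt1.
Qed.

End ModP.

(** * Divisibility by powers of theta *)

Section Theta.
Variable p : nat.
Hypothesis p_pr : prime p.
Local Notation F := 'F_p.

Lemma dvdp_exp_XsubC (f : {poly F}) a n :
  (forall j, (j < n)%N -> (f \Po ('X + a%:P))`_j = 0) -> ('X - a%:P) ^+ n %| f.
Proof.
move=> f0; have /dvdpP[q fq] : 'X^n %| f \Po ('X + a%:P).
  apply/dvdpP; exists (drop_poly n (f \Po ('X + a%:P))).
  rewrite -[LHS](poly_take_drop n) [take_poly _ _](_ : _ = 0) ?add0r //.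
  by apply/polyP => j; rewrite coef_take_poly coef0; case: ifP => // /f0.
apply/dvdpP; exists (q \Po ('X - a%:P)).
rewrite -[LHS]comp_polyXr -(comp_Xn_poly ('X - a%:P)) -comp_polyM -fq -comp_polyA.
by rewrite comp_polyD comp_polyX comp_polyC subrK.
Qed.

Lemma dvdp_theta_exp (f : {poly F}) n :
  (forall a, ('X - a%:P) ^+ n %| f) -> ('X - 'X^p) ^+ n %| f.
Proof.
move=> f0.
have E : 'X - 'X^p = - \prod_a ('X - a%:P) :> {poly F}.
  by rewrite -finField_genPoly card_Fp // opprB.
rewrite E exprNn -signr_odd.
apply: dvdp_trans (_ : (\prod_a ('X - a%:P)) ^+ n %| f).
  by case: odd; rewrite ?expr1 ?mulN1r ?dvdpNl ?expr0 ?mul1r.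
rewrite -big_enum; have := enum_uniq F.
elim: (enum F) => [|a l IH] /=; first by rewrite big_nil expr1n dvd1p.
case/andP=> al ul; rewrite big_cons exprMn Gauss_dvdp ?f0 ?IH //.
rewrite coprimep_expl // coprimep_expr // coprimep_sym coprimep_XsubC.
by rewrite root_prod_XsubC.
Qed.

Definition Vjet r A (P : Vr p r) : {poly F} :=
  jet A (mpoly_of_dhomog (P : dhomog 2 F r)).

Lemma Vjet_linear r A : linear (@Vjet r A).
Proof. move=> a P Q; exact: jet_linear. Qed.

HB.instance Definition _ r A :=
  GRing.isLinear.Build F (Vr p r) {poly F} _ (@Vjet r A) (@Vjet_linear r A).

Lemma Vjet_act r A g (P : Vr p r) :
  Vjet A (Defs.act (Vr p r) g P) = Vjet (A *m GLval g) P.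
Proof. exact: jet_subst. Qed.

(** If the jets of P vanish to order n, those at the affine points show that the
    dehomogenization f of P is divisible by (x - a)^n for all a in F_p, hence
    by (x - x^p)^n, and those at infinity that f has degree at most r - n, so
    that the quotient has the degree of a form of degree r - n (p + 1). *)
Lemma VthetaP r n (P : Vr p r) :
  reflect (forall A j, (j < n)%N -> (Vjet A P)`_j = 0) (P \in Vtheta r p_pr n).
Proof.
rewrite /Vjet; apply: (iffP (asboolP _)) => [[Q PQ] A j jn|P0].
  rewrite [mpoly_of_dhomog _](PQ : _ = theta F p ^+ n * Q).
  by rewrite jet_theta // coefZ (coef_theta_exp p_pr n _).1 ?mulr0.
set P' := mpoly_of_dhomog _ in P0 *.
have homP : P' \is r.-homog by exact: dhomog_is_dhomog.
have szP := size_dehom homP; set f := dehom P' in szP.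
suff : exists Q, P' = theta F p ^+ n * Q by [].
have /dvdpP[q fq] : ('X - 'X^p) ^+ n %| f.
  apply: dvdp_theta_exp => a; apply: dvdp_exp_XsubC => j jn.
  by rewrite -(jet_aff _ szP) dehomK // P0.
have [q0|q_neq0] := eqVneq q 0.
  exists 0; rewrite mulr0; apply: (homog_dehom_inj homP); first exact: rpred0.
  by rewrite raddf0 -/f fq q0 mul0r.
have szf : (size f <= r.+1 - n)%N.
  apply/leq_sizeP => j jn; have [jr|rj] := leqP j r; last first.
    by rewrite nth_default // (leq_trans szP).
  rewrite -[j](subKn jr) -jet_inf ?leq_subr // dehomK // P0 //.
  by rewrite ltn_subLR // addnC -leq_subLR.
have szT : size ('X - 'X^p : {poly F}) = p.+1.
  rewrite -opprB size_polyN size_polyDl size_polyXn // size_polyN size_polyX.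
  by rewrite ltnS prime_gt1.
have T_neq0 : ('X - 'X^p) ^+ n != 0 :> {poly F}.
  by rewrite expf_neq0 // -size_poly_gt0 szT.
have sq : (n * p.+1 + (size q).-1 <= r)%N.
  have := size_exp ('X - 'X^p : {poly F}) n; rewrite szT /=.
  have q_gt0 : (0 < size q)%N by rewrite size_poly_gt0.
  have T_gt0 : (0 < size (('X - 'X^p) ^+ n : {poly F})%R)%N.
    by rewrite size_poly_gt0.
  move: szf q_gt0 T_gt0; rewrite fq size_mul //.
  set b := size (polyseq (_ ^+ n)); move: (size q) b => a b.
  by rewrite mulnS [(n * p)%N]mulnC; lia.
exists (bform (r - n * p.+1) q).
have le_r : (n * p.+1 <= r)%N := leq_trans (leq_addr _ _) sq.
apply: (homog_dehom_inj homP).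
  rewrite -(subnKC le_r); apply: dhomogM; last by rewrite addKn bform_homog.
  by rewrite mulnC; apply: dhomogMn; apply: theta_homog.
rewrite rmorphM rmorphXn /= dehom_theta bformK -/f ?fq 1?mulrC //.
by rewrite -[size q]prednK ?size_poly_gt0 // ltnS leq_subRL.
Qed.

End Theta.

(** * The complement cut out by a gap in the Taylor expansions *)

Section TaylorGap.
Variables (p r : nat) (p_pr : prime p).
Local Notation F := 'F_p.

Lemma jet_pt0 n (g : {poly F}) u : (size g <= n.+1)%N ->
  (jet (pt_mx u) (bform n g))`_0 = if u is Some a then g.[a] else g`_n.
Proof.
move=> sg; case: u => [a|]; last by rewrite jet_inf ?subn0.
by rewrite jet_aff // -horner_coef0 horner_comp !hornerE.
Qed.

(** The values of the coefficient of order n can be prescribed on theta^n G: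
    this coefficient is the value of G, times the nonzero factor by which the
    frame transforms theta^n. *)
Lemma Vtheta_lift n (v : option F -> F) : (n * p.+1 + p <= r)%N ->
  exists2 H : Vr p r, H \in Vtheta r p_pr n &
    forall u, (Vjet (pt_mx u) H)`_n = v u.
Proof.
move=> nr; set s := (r - n * p.+1)%N.
have ps : (p <= s)%N by rewrite leq_subRL ?(leq_trans _ nr) ?leq_addr.
have [g [sg ga gs]] := interpolation p_pr (fun u => v u / \det (pt_mx u) ^+ n) ps.
have homH : theta F p ^+ n * bform s g \is r.-homog.
  rewrite -(@subnKC (n * p.+1) r) ?(leq_trans _ nr) ?leq_addr //.
  apply: dhomogM; last exact: bform_homog.
  by rewrite mulnC; apply: dhomogMn; apply: theta_homog.
exists (DHomog homH : Vr p r); first by apply/asboolP; exists (bform s g).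
move=> u; rewrite /Vjet /= jet_theta // coefZ (coef_theta_exp p_pr n _).2 jet_pt0 //.
have -> : (if u is Some a then g.[a] else g`_s) = v u / \det (pt_mx u) ^+ n.
  by case: u.
by rewrite mulrC divfK // expf_neq0 // pt_mx_det.
Qed.

Definition gap_pred i m : {pred Vr p r} :=
  fun P => `[< forall A, gap i m (Vjet A P) >].

Lemma gap_closed i m : submod_closed (gap_pred i m).
Proof.
split=> [|a P Q /asboolP gP /asboolP gQ]; apply/asboolP => A.
  by move=> j _; rewrite raddf0 coef0.
rewrite Vjet_linear; exact: gap_linear.
Qed.

Lemma gap_act i m g P :
  P \in gap_pred i m -> Defs.act (Vr p r) g P \in gap_pred i m.
Proof. by move=> /asboolP gP; apply/asboolP => A; rewrite Vjet_act. Qed.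

Definition Vgap i m : subrep (Vr p r) := SubRep (gap_closed i m) (@gap_act i m).

Lemma Vtheta_mono n n' (P : Vr p r) : (n <= n')%N ->
  P \in Vtheta r p_pr n' -> P \in Vtheta r p_pr n.
Proof.
by move=> nn /VthetaP H; apply/VthetaP => A j jn; rewrite H // (leq_trans jn).
Qed.

(** Induction on m: if W corrects the orders up to m, a form divisible by
    theta^(m+1) corrects the order m + 1 without changing the previous ones. *)
Lemma gap_lift i m (P : Vr p r) : (m * p.+1 + p <= r)%N ->
  exists2 W : Vr p r, W \in Vtheta r p_pr i.+1 &
    forall u, gap i m (Vjet (pt_mx u) (P - W)).
Proof.
elim: m => [|m IH] mr.
  by exists 0; [exact: rpred0 | move=> u j; lia].
have [W WV gW] : exists2 W : Vr p r, W \in Vtheta r p_pr i.+1 &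
    forall u, gap i m (Vjet (pt_mx u) (P - W)) by apply: IH; nia.
have [mi|im] := leqP m.+1 i; first by exists W => // u j; lia.
have [H HV Hv] := Vtheta_lift (fun u => (Vjet (pt_mx u) (P - W))`_m.+1) mr.
exists (W + H); first by rewrite rpredD // (Vtheta_mono _ HV).
move=> u; rewrite opprD addrA (raddfB (Vjet (pt_mx u))).
apply: gap_subr (gW u) _ (Hv u); exact: (elimT (VthetaP _ _ _) HV).
Qed.

Lemma Vgap_frames i m (P : Vr p r) : (i <= r)%N -> (p %| r - i)%N -> (m < p)%N ->
  (forall u, gap i m (Vjet (pt_mx u) P)) -> P \in Vgap i m.
Proof.
move=> ir pri mp gP; apply/asboolP => A.
have [b [u [b01 ->]]] := frame_decomposition A; rewrite /Vjet -jet_subst.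
apply: gap_lower pri mp b01 _ => //; last exact: gP.
exact/subst_homog/dhomog_is_dhomog.
Qed.

End TaylorGap.

(** * Prime divisors of binomial coefficients *)

Section Binomial.
Local Open Scope nat_scope.

Lemma coprime_prime_fact p m : prime p -> m < p -> coprime p m`!.
Proof.
move=> p_pr; elim: m => [|m IH] mp; first by rewrite fact0 coprimen1.
by rewrite factS coprimeMr (IH (ltnW mp)) andbT prime_coprime // gtnNdvd.
Qed.

(** As m! is prime to p, divisibility by p may be tested on
    m! 'C(r, m) = r (r - 1) ... (r - m + 1). *)
Lemma prime_dvd_bin p r m : prime p -> m < p ->
  p %| 'C(r, m) <-> exists i, i < m /\ p %| r - i.
Proof.
move=> p_pr mp; rewrite -(Gauss_dvdl _ (coprime_prime_fact p_pr mp)) bin_ffact.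
rewrite ffact_prod Euclid_dvd_prod // big_orE.
split=> [/existsP[i pri] | [i [im pri]]]; first by exists i.
by apply/existsP; exists (Ordinal im).
Qed.

End Binomial.

Theorem corollary2p8 (p m r : nat) (p_pr : prime p) (hm : (m <= p - 1)%N)
    (hr : ((m + 1) * (p + 1) - 1 <= r)%N) :
  ((p %| 'C(r, m))%N <-> exists i : nat, (i < m)%N /\ (p %| r - i)%N) /\
  (forall i : nat, (i < m)%N -> (p %| r - i)%N ->
     rep_iso (quo_rep (Vtheta r p_pr (m + 1)))
             (sum_rep (quo_rep (Vtheta r p_pr (i + 1)))
                      (quo_rep (restrict (Vtheta r p_pr (i + 1))
                                         (Vtheta r p_pr (m + 1)))))).
Proof.
have mp : (m < p)%N by have := prime_gt0 p_pr; lia.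
have mr : (m * p.+1 + p <= r)%N by nia.
split=> [|i im pri]; first exact: prime_dvd_bin.
have ir : (i <= r)%N by nia.
rewrite !addn1; apply: (complement_split (C := Vgap p r i m)).
- by move=> P; apply: Vtheta_mono; apply: ltnW.
- by move=> P /VthetaP HP; apply/asboolP => A j /andP[_ jm]; apply: HP.
- move=> P /VthetaP HP /asboolP gP; apply/VthetaP => A j jm.
  by have [ji|ij] := leqP j i; [apply: HP | apply: gP; rewrite ij].
by move=> P; have [W WV gW] := gap_lift p_pr i P mr; exists W => //; apply: Vgap_frames.
Qed.
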